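(* For $k\ge 1$, $$\frac{n-k-1}{k+1}\,N_k^{n,r}=\frac{n-2k}{k}\,N_{k-1}^{n,r}+N_{k-2}^{n-1,r}+N_{k-2}^{n-1,r-1}.$$
   Context: A lattice path of length $n$ here is a path in the plane starting at the origin $(0,0)$ and consisting of $n$ unit steps, each either E $=(1,0)$ or N $=(0,1)$. Let $N_k^{n,r}$ be the number of ordered pairs of lattice paths of length $n$, both ending at $(r,n-r)$, that intersect exactly $k$ times, where intersections at the origin and at the common endpoint are not counted; that is, there are exactly $k$ indices $m$ with $1\le m\le n-1$ such that the two paths are at the same lattice point after $m$ steps.
   Formalization: The identity is proved for n ≥ 2; for n = 1 it fails as stated (k = 1, r = 0 gives 0 = −1), and for n = 0 the right side refers to paths of length −1. *)

(* Defs.v *)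
From mathcomp Require Import all_boot all_order all_algebra.

Set Implicit Arguments.
Unset Strict Implicit.
Unset Printing Implicit Defensive.

Import Order.TTheory GRing.Theory Num.Theory.
Local Open Scope ring_scope.

(* A lattice path of length n is encoded by its sequence of steps,
   true standing for E = (1,0) and false for N = (0,1). *)
Definition path_of_length (n : nat) : finType := n.-tuple bool.

Definition step (e : bool) : int * int := if e then (1, 0) else (0, 1).

Definition point_after (p : seq bool) (m : nat) : int * int :=
  \sum_(e <- take m p) step e.

(* An index m : 'I_n with 0 < m is exactly an m with 1 <= m <= n - 1. *)
Definition num_intersections (n : nat) (p q : path_of_length n) : nat :=
  #|[set m : 'I_n | (0 < m)%N && (point_after p m == point_after q m)]|.

(* N_k^{n,r}; k and r range over all integers, so that the values at k = -1
   and at r = -1 are counts like any other (and are 0). *)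
Definition num_pairs (n : nat) (r k : int) : nat :=
  #|[set pq : path_of_length n * path_of_length n |
      [&& point_after pq.1 n == (r, n%:Z - r),
          point_after pq.2 n == (r, n%:Z - r) &
          (num_intersections pq.1 pq.2)%:Z == k]]|.

(* Main.v *)
Require Import Defs.
From mathcomp Require Import all_boot all_order all_algebra.
From mathcomp Require Import zify ring lra.

(* Let [F_j(x, t)] be the generating function of the pairs of paths with a
   common end that meet [j] times after the origin, the end included, where [t]
   marks the length and [x] the number of E steps.  Cutting at the first return
   gives [F_j = P ^ j] with [P = F_1], and [T (1 - P) = 1] for
   [T = \sum_j F_j = \sum_(n, r) 'C(n, r) ^ 2 x ^ r t ^ n].  The recurrence of
   the coefficients of [T] in [t] is a differential equation whose solution is
   [T ^ 2 D = 1], [D = 1 - 2 (1 + x) t + (1 - x) ^ 2 t ^ 2]; hence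
   [(1 - P) ^ 2 = D].  Applying [E = t d/dt] and eliminating [t ^ 2] yields
   [(P - 1) E P = P ^ 2 - 2 P + (1 + x) t]; multiplied by [P ^ (k - 1)], this is
   the theorem, coefficient by coefficient.  Power series in [t] are replaced by
   polynomials, with equality up to a fixed degree. *)

Set Implicit Arguments.
Unset Strict Implicit.
Unset Printing Implicit Defensive.

Import Order.TTheory GRing.Theory Num.Theory.
Local Open Scope ring_scope.

(** * Pairs of paths as walks of their excess, refined by the number of returns *)

Definition gap (d : int) (p q : seq bool) (m : nat) : int :=
  d + (count id (take m p))%:Z - (count id (take m q))%:Z.

Definition returns (d : int) (p q : seq bool) (n : nat) : nat :=
  count (fun m => gap d p q m == 0) (iota 1 n).

(* [d] is the initial excess of E steps of the first path over the second;
   [Q] selects the admissible numbers of returns of the excess to 0. *)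
Definition pair_gf (Q : pred nat) (n : nat) (d : int) : {poly rat} :=
  \sum_(p : n.-tuple bool) \sum_(q : n.-tuple bool)
    if Q (returns d p q n) && (gap d p q n == 0) then 'X^(count id p) else 0.

Lemma big_tuple_cons (V : nmodType) (T : finType) (n : nat) (G : seq T -> V) :
  \sum_(p : n.+1.-tuple T) G p = \sum_(a : T) \sum_(p : n.-tuple T) G (a :: p).
Proof.
rewrite pair_big /=.
rewrite (reindex (fun ap : T * n.-tuple T => cons_tuple ap.1 ap.2)) /=.
  by apply: eq_bigr => -[].
exists (fun p => (thead p, behead_tuple p)) => [[a p] _|p _] /=.
  by congr pair; apply: val_inj.
by apply: val_inj; case: p => -[].
Qed.

Lemma gap_cons d a b p q m :
  gap d (a :: p) (b :: q) m.+1 = gap (d + a%:Z - b%:Z) p q m.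
Proof. by rewrite /gap /= !PoszD; ring. Qed.

Lemma returns_cons d a b p q n :
  returns d (a :: p) (b :: q) n.+1 =
  ((d + a%:Z - b%:Z == 0)%R + returns (d + a%:Z - b%:Z)%R p q n)%N.
Proof.
rewrite /returns /= gap_cons {1}/gap !take0 /= addr0 subr0; congr addn.
rewrite -[2%N]/(1 + 1)%N iotaDl count_map; apply: eq_count => m /=.
by rewrite add1n gap_cons.
Qed.

Lemma eq_pair_gf Q Q' n d : Q =1 Q' -> pair_gf Q n d = pair_gf Q' n d.
Proof.
by move=> eQ; apply: eq_bigr => p _; apply: eq_bigr => q _; rewrite eQ.
Qed.

Lemma pair_gf0 Q d :
  pair_gf Q 0 d = if Q 0%N && (d == 0) then 1 else 0.
Proof.
rewrite /pair_gf (big_pred1 [tuple]) => [|p]; last exact/esym/eqP/tuple0.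
rewrite (big_pred1 [tuple]) => [|p]; last exact/esym/eqP/tuple0.
by rewrite /gap /= addr0 subr0.
Qed.

(** Removing the first steps moves the excess to [e]; if [e] is 0 this already is a return, so [Q]
    is shifted. *)
Lemma pair_gfS Q n d :
  pair_gf Q n.+1 d = \sum_(a : bool) \sum_(b : bool) 'X^a *
    let e := d + a%:Z - b%:Z in
    pair_gf (if e == 0 then fun i => Q i.+1 else Q) n e.
Proof.
rewrite /pair_gf.
rewrite (big_tuple_cons _ (fun p : seq bool => \sum_(q : n.+1.-tuple bool)
  if Q (returns d p q n.+1) && (gap d p q n.+1 == 0)
  then 'X^(count id p) else 0)).
apply: eq_bigr => a _.
under eq_bigr => p _ do rewrite (big_tuple_cons _ (fun q : seq bool =>
  if Q (returns d (a :: p) q n.+1) && (gap d (a :: p) q n.+1 == 0)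
  then 'X^(count id (a :: p)) else 0)).
rewrite exchange_big /=; apply: eq_bigr => b _.
rewrite big_distrr /=; apply: eq_bigr => p _.
rewrite big_distrr /=; apply: eq_bigr => q _.
rewrite returns_cons gap_cons exprD.
by case: (_ + _ - _ == 0); case: ifP; rewrite ?mulr0.
Qed.

(** * The first-return decomposition *)

Lemma returns_closed_gt0 d p q n :
  (0 < n)%N -> gap d p q n == 0 -> (0 < returns d p q n)%N.
Proof.
move=> n0 g0; rewrite -has_count; apply/hasP; exists n => //.
by rewrite mem_iota; lia.
Qed.

Lemma eq_pair_gf_gt0 Q Q' n d :
  (0 < n)%N -> (forall i, Q i.+1 = Q' i.+1) -> pair_gf Q n d = pair_gf Q' n d.
Proof.
move=> n0 eQ; apply: eq_bigr => p _; apply: eq_bigr => q _.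
case: eqP => [/eqP g0|]; last by rewrite !andbF.
by case: (returns _ _ _ _) (returns_closed_gt0 n0 g0) => // i _; rewrite eQ.
Qed.

Lemma pair_gf_no_return n : pair_gf (pred1 0%N) n 0 = (n == 0%N)%:R.
Proof.
case: n => [|n]; first by rewrite pair_gf0 eqxx.
rewrite (@eq_pair_gf_gt0 _ pred0) // /pair_gf /=.
by rewrite big1 // => p _; rewrite big1.
Qed.

(** The summand [m] collects the pairs that first return at [m]: up to there the end is the only
    return. The start [d] is arbitrary because the induction removes first steps. *)
Lemma pair_gf_renewal Q n d : ~~ Q 0%N ->
  pair_gf Q n d =
  \sum_(m < n.+1) pair_gf (pred1 1%N) m d * pair_gf (fun i => Q i.+1) (n - m) 0.
Proof.
move=> /negbTE Q0; elim: n d => [|n IHn] d.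
  by rewrite big_ord1 !pair_gf0 Q0 mul0r.
rewrite big_ord_recl pair_gf0 mul0r add0r pair_gfS.
under [RHS]eq_bigr => m _ do rewrite /= pair_gfS big_distrl /=.
rewrite [RHS]exchange_big /=; apply: eq_bigr => a _.
under [RHS]eq_bigr => m _ do rewrite big_distrl /=.
rewrite [RHS]exchange_big /=; apply: eq_bigr => b _.
under [RHS]eq_bigr => m _ do rewrite -mulrA.
rewrite -big_distrr /=; congr (_ * _).
set e := (d + _ - _).
(* If [e] is 0, the first return is at index 1, so only the first term of the shifted sum
   survives. *)
have [->|e0] := eqVneq e 0; last by rewrite IHn.
rewrite big_ord_recl /= big1 ?addr0 => [|m _].
  by rewrite pair_gf_no_return mul1r subSS subn0.
by rewrite pair_gf_no_return mul0r.
Qed.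

(** * Unrestricted returns: squares of binomial coefficients *)

Definition binz (n : nat) (z : int) : rat := if z is Posz m then 'C(n, m)%:R else 0.

Lemma binzS n z : binz n.+1 z = binz n z + binz n (z - 1).
Proof.
case: z => [[|m]|m] /=; rewrite ?bin0 ?addr0 //.
by rewrite subSS subn0 -natrD binS.
Qed.

(** The two paths are chosen independently, with [r] and [r + d] E steps; [r + d] may be negative,
    hence [binz]. *)
Lemma coef_pair_gf_all n d r :
  (pair_gf predT n d)`_r = binz n r * binz n (r%:Z + d).
Proof.
elim: n d r => [|n IHn] d r.
  rewrite pair_gf0 /=; case: r => [|r] /=.
    rewrite add0r; case: eqP => [->|]; rewrite ?coef1 ?coef0 //=.
    by case: d => [[|d]|d] //=; rewrite ?mulr0.
  by rewrite mul0r; case: ifP; rewrite ?coef1 ?coef0.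
have fT e : (if e == 0 :> int then fun=> true else predT) =1 (predT : pred nat).
  by case: ifP.
rewrite pair_gfS.
rewrite !big_bool /= !(eq_pair_gf _ _ (fT _)) !expr1 !expr0 !mul1r !coefD !coefXM.
rewrite !IHn.
rewrite !binzS.
case: r => [|r] /=.
  rewrite !bin0 !mul1r 2!add0r addrC; congr (binz _ _ + binz _ _); lia.
rewrite binS natrD.
have -> : r%:Z + (d + 1 - 1) = r.+1%:Z + d - 1 by lia.
have -> : r%:Z + (d + 1 - 0) = r.+1%:Z + d by lia.
have -> : r.+1%:Z + (d + 0 - 1) = r.+1%:Z + d - 1 by lia.
have -> : r.+1%:Z + (d + 0 - 0) = r.+1%:Z + d by lia.
ring.
Qed.

Lemma coef_closed_gf n r : (pair_gf predT n 0)`_r = 'C(n, r)%:R ^+ 2.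
Proof. by rewrite coef_pair_gf_all addr0. Qed.

(** The ratios of consecutive binomials express [b] and [c] through [a], which leaves an identity of
    rational functions. *)
Lemma bin_consecutive_rel (n r : nat) :
  let a : rat := 'C(n, r)%:R in
  let b : rat := 'C(n, r.+1)%:R in
  let c : rat := 'C(n, r.+2)%:R in
  n%:R * b ^+ 2 = a * b + b * c + n.+2%:R * a * c.
Proof.
move=> a b c.
have eb : r.+1%:R * b = (n%:R - r%:R) * a.
  have [le_rn|lt_nr] := leqP r n; first by rewrite -natrB // -!natrM mul_bin_left.
  by rewrite /a /b !bin_small ?mulr0 //; lia.
have ec : r.+2%:R * c = (n%:R - r.+1%:R) * b.
  have [le_rn|lt_nr] := leqP r.+1 n; first by rewrite -natrB // -!natrM mul_bin_left.
  by rewrite /c /b !bin_small ?mulr0 //; lia.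
have r0 : (r%:R : rat) >= 0 by rewrite ler0n.
move: eb ec; rewrite -?natr1 => eb ec.
have -> : c = (n%:R - (r%:R + 1)) * b / (r%:R + 1 + 1).
  by rewrite -ec mulrAC mulfV ?mul1r //; lra.
have -> : b = (n%:R - r%:R) * a / (r%:R + 1).
  by rewrite -eb mulrAC mulfV ?mul1r //; lra.
field.
by apply/andP; split; lra.
Qed.

(** This is Bonnet's recurrence for the Legendre polynomials [L_n], since [\sum_r 'C(n, r) ^ 2 x ^ r
    = (1 - x) ^ n L_n((1 + x) / (1 - x))]. *)
Lemma closed_gf_rec n :
  pair_gf predT n.+2 0 *+ n.+2 =
  (1 + 'X) * pair_gf predT n.+1 0 *+ (2 * n + 3)
  - (1 - 'X) ^+ 2 * pair_gf predT n 0 *+ n.+1.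
Proof.
apply/polyP => r.
have -> : (1 - 'X) ^+ 2 = 1 - 'X *+ 2 + 'X^2 :> {poly rat} by ring.
rewrite !mulrDl !mulNr !mulrnAl !mul1r !(coefB, coefD, coefMn, coefN, coefXM, coefXnM).
rewrite !coef_closed_gf.
case: r => [|[|r]] /=.
- by rewrite !bin0; ring.
- by rewrite !bin0 !bin1; ring.
have -> : (r.+2 - 2)%N = r by lia.
rewrite !binS !natrD.
have := bin_consecutive_rel n r; cbv zeta.
move: 'C(n, r)%:R 'C(n, r.+1)%:R 'C(n, r.+2)%:R => a b c e.
apply/eqP; rewrite -subr_eq0; apply/eqP.
(* After Pascal's rule only entries of row [n] remain, and the two sides differ by a multiple of
   [bin_consecutive_rel]. *)
transitivity (- 2 * (n%:R * b ^+ 2 - (a * b + b * c + n.+2%:R * a * c))).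
  ring.
rewrite e; ring.
Qed.

(** * Power series modulo a power of the variable *)

Section Series.

Variable R : comNzRingType.
Implicit Types p q : {poly R}.

(** Unlike the plain derivative, this operator preserves vanishing below a given degree. *)
Definition euler p := 'X * p^`().

Lemma coef_euler p i : (euler p)`_i = p`_i *+ i.
Proof. by rewrite coefXM coef_deriv; case: i => [|i]; rewrite ?mulr0n. Qed.

Lemma eulerB p q : euler (p - q) = euler p - euler q.
Proof. by rewrite /euler derivB mulrBr. Qed.

Lemma eulerM p q : euler (p * q) = euler p * q + p * euler q.
Proof. by rewrite /euler derivM; ring. Qed.

Lemma eulerXn p n : euler (p ^+ n.+1) = p ^+ n * euler p *+ n.+1.
Proof. by rewrite /euler deriv_exp -mulrnAr; ring. Qed.

Lemma euler_sqrM p q :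
  euler (p ^+ 2 * q) = p * (q * euler p *+ 2 + euler q * p).
Proof. by rewrite expr2 !eulerM; ring. Qed.

Definition small M p := forall i, (i < M)%N -> p`_i = 0.

Lemma smallD M p q : small M p -> small M q -> small M (p + q).
Proof. by move=> hp hq i iM; rewrite coefD hp // hq // addr0. Qed.

Lemma smallM M q p : small M p -> small M (q * p).
Proof.
move=> hp i iM; rewrite coefM big1 // => j _.
by rewrite hp ?mulr0 // (leq_ltn_trans (leq_subr _ _) iM).
Qed.

Lemma small_euler M p : small M p -> small M (euler p).
Proof. by move=> hp i iM; rewrite coef_euler hp // mul0rn. Qed.

End Series.

(** * The truncations of [T] and [P], with [t] as outer and [x] as inner variable *)

Definition closed_series M : {poly {poly rat}} := \poly_(n < M) pair_gf predT n 0.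
Definition prime_series M : {poly {poly rat}} := \poly_(n < M) pair_gf (pred1 1%N) n 0.

Definition discr : {poly {poly rat}} :=
  1 - (1 + 'X)%:P * 'X *+ 2 + ((1 - 'X) ^+ 2)%:P * 'X ^+ 2.

Lemma euler_discr :
  euler discr = ((1 - 'X) ^+ 2)%:P * 'X ^+ 2 *+ 2 - (1 + 'X)%:P * 'X *+ 2.
Proof.
rewrite /euler /discr expr2 derivD derivB derivMn !derivM !derivC derivX; ring.
Qed.

Lemma closed_gf0 : pair_gf predT 0 0 = 1.
Proof. by rewrite pair_gf0. Qed.

Lemma closed_gf1 : pair_gf predT 1 0 = 1 + 'X.
Proof.
apply/polyP => r; rewrite coef_closed_gf coefD coef1 coefX.
by case: r => [|[|r]] //=; rewrite ?bin_small // ?expr0n ?addr0 ?add0r.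
Qed.

(** In degree [n + 2] the coefficient is twice the difference of the two sides of [closed_gf_rec];
    degrees 0 and 1 are checked directly. *)
Lemma closed_series_ode M :
  small M (discr * euler (closed_series M) *+ 2 + euler discr * closed_series M).
Proof.
set T := closed_series M.
have -> : discr * euler T *+ 2 + euler discr * T =
  euler T *+ 2 - (1 + 'X)%:P * ('X * (euler T *+ 4 + T *+ 2))
    + ((1 - 'X) ^+ 2)%:P * ('X^2 * (euler T *+ 2 + T *+ 2)).
  by rewrite euler_discr /discr; ring.
move=> i iM; rewrite !(coef_euler, coefB, coefD, coefCM, coefXM, coefXnM, coefMn).
have Tn j : (j <= i)%N -> T`_j = pair_gf predT j 0.
  by move=> ji; rewrite coef_poly (leq_ltn_trans ji iM).
case: i iM Tn => [|[|i]] iM Tn /=;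
  rewrite ?subSS ?subn0 !Tn ?closed_gf0 ?closed_gf1 //; try by ring.
  by rewrite closed_gf_rec; ring.
by lia.
Qed.

(** [euler] of [T ^ 2 D] is [T] times the differential equation, so the coefficients in positive
    degrees below [M] vanish in characteristic 0. *)
Lemma small_closed_series_discr M :
  small M (closed_series M ^+ 2 * discr - 1).
Proof.
set T := closed_series M.
have sE : small M (euler (T ^+ 2 * discr)).
  by rewrite euler_sqrM; exact/smallM/closed_series_ode.
case=> [|i] iM; rewrite coefB coef1 /=.
  rewrite expr2 !coef0M coef_poly iM closed_gf0 /discr.
  by rewrite !(coefD, coefN, coefMn, coefCM, coefX, coefXn, coef1) /=; ring.
rewrite subr0; have /eqP := sE _ iM; rewrite coef_euler.
rewrite -scaler_nat scaler_eq0 pnatr_eq0 /= => /eqP //.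
Qed.

Lemma small_renewal M :
  small M (closed_series M * (1 - prime_series M) - 1).
Proof.
move=> i iM.
rewrite mulrBr mulr1 mulrC !coefB coef1 coefM coef_poly iM.
under eq_bigr => j _ do rewrite !coef_poly (leq_ltn_trans (leq_subr _ _) iM)
  (leq_trans (ltn_ord j)) //.
case: i iM => [|i] iM.
  by rewrite big_ord1 !pair_gf0 /= mul0r subr0 subrr.
(* A closed pair of positive length has a return, so [predT] may be replaced by a predicate false at
   0, whose shift is again [predT]. *)
rewrite (@eq_pair_gf_gt0 _ (fun r => 0 < r)%N) // pair_gf_renewal //.
by rewrite subr0 subrr.
Qed.

Lemma coef_prime_series_exp M j i : (i < M)%N ->
  (prime_series M ^+ j)`_i = pair_gf (pred1 j) i 0.
Proof.
elim: j i => [|j IHj] i iM; first by rewrite coef1 pair_gf_no_return.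
rewrite exprS coefM pair_gf_renewal //.
apply: eq_bigr => m _; rewrite coef_poly (leq_trans (ltn_ord m)) // IHj //.
exact: leq_ltn_trans (leq_subr _ _) iM.
Qed.

Lemma small_prime_series_quadratic M :
  small M ((1 - prime_series M) ^+ 2 - discr).
Proof.
set P := prime_series M; set T := closed_series M.
(* This writes the difference as a combination of [T ^ 2 D - 1] and [T (1 - P) - 1], avoiding
   division by [T]. *)
have -> : (1 - P) ^+ 2 - discr =
    - (1 - P) ^+ 2 * (T ^+ 2 * discr - 1)
    + discr * (T * (1 - P) + 1) * (T * (1 - P) - 1) by ring.
by apply: smallD; apply: smallM;
  [exact: small_closed_series_discr|exact: small_renewal].
Qed.

Lemma pair_gf_returns_rec k n :
  pair_gf (pred1 k.+2) n.+1 0 *+ (k.+1 * n.+1)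
  - pair_gf (pred1 k.+1) n.+1 0 *+ (k.+2 * n.+1) =
  (pair_gf (pred1 k.+2) n.+1 0 - pair_gf (pred1 k.+1) n.+1 0 *+ 2
   + (1 + 'X) * pair_gf (pred1 k) n 0) *+ (k.+1 * k.+2).
Proof.
pose P := prime_series n.+2.
pose Q := (1 - P) ^+ 2 - discr.
have sQ : small n.+2 Q by exact: small_prime_series_quadratic.
have eQ : euler Q = (P - 1) * euler P *+ 2 - euler discr.
  rewrite eulerB eulerXn eulerB /euler derivC; ring.
(* In [euler Q - 2 Q] the [t ^ 2] terms cancel; the multiplier turns the products of powers of [P]
   with [euler P] into multiples of [euler] of [P ^ (k + 2)] and [P ^ (k + 1)]. *)
have := smallM (P ^+ k *+ (k.+1 * k.+2))
  (smallD (small_euler sQ) (smallM (-2) sQ)).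
have -> : P ^+ k *+ (k.+1 * k.+2) * (euler Q + -2 * Q) =
  (euler (P ^+ k.+2) *+ k.+1 - euler (P ^+ k.+1) *+ k.+2
   - (P ^+ k.+2 - P ^+ k.+1 *+ 2 + (1 + 'X)%:P * ('X * P ^+ k)) *+ (k.+1 * k.+2))
    *+ 2.
  rewrite eQ !eulerXn euler_discr /Q /discr !exprS; ring.
move=> /(_ n.+1 (leqnn _)).
rewrite !(coef_euler, coefMn, coefB, coefD, coefCM, coefXM) /=.
rewrite !coef_prime_series_exp // -[LHS]scaler_nat => /eqP.
rewrite scaler_eq0 pnatr_eq0 /= subr_eq0 => /eqP.
by rewrite -!mulrnA ![(n.+1 * _)%N]mulnC.
Qed.

(** * Back to lattice paths and their intersections *)

Lemma point_afterE (p : seq bool) m :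
  point_after p m =
    ((count id (take m p))%:Z, (size (take m p))%:Z - (count id (take m p))%:Z).
Proof.
rewrite /point_after; elim: (take m p) => [|e s IHs]; first by rewrite big_nil.
by rewrite big_cons IHs; case: e; apply/eqP; rewrite xpair_eqE /=; lia.
Qed.

Lemma point_after_end n (p : path_of_length n) (r : int) :
  (point_after p n == (r, n%:Z - r)) = ((count id p)%:Z == r).
Proof.
rewrite point_afterE take_oversize ?size_tuple // xpair_eqE.
by case: eqP => //= ->; rewrite eqxx.
Qed.

Lemma point_after_eq n (p q : path_of_length n) m :
  (point_after p m == point_after q m) = (gap 0 p q m == 0).
Proof.
rewrite !point_afterE !size_take !size_tuple xpair_eqE /gap add0r subr_eq0.
by case: eqP => //= ->; rewrite eqxx.
Qed.

Lemma gap_end n (p q : path_of_length n) :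
  (gap 0 p q n == 0) = (count id p == count id q).
Proof. by rewrite /gap !take_oversize ?size_tuple // add0r subr_eq0. Qed.

(* The common endpoint is a return but not an intersection. *)
Lemma num_intersectionsS n (p q : path_of_length n) :
  (0 < n)%N -> count id p = count id q ->
  (num_intersections p q).+1 = returns 0 p q n.
Proof.
move=> n_gt0 pq; rewrite /num_intersections cardsE -sum1_card.
under eq_bigl => m do rewrite unfold_in /= point_after_eq.
rewrite -(big_mkord (fun m => (0 < m)%N && (gap 0 p q m == 0)) (fun=> 1%N)).
rewrite sum1_count /index_iota subn0 /returns.
move/eqP: pq; rewrite -gap_end.
case: n p q n_gt0 => // n p q _ ge.
rewrite (_ : iota 1 n.+1 = rcons (iota 1 n) n.+1); last first.
  by rewrite -{1}(addn1 n) iotaD cats1 add1n.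
rewrite -cats1 count_cat /= ge /= addn0 addn1 add0n.
congr S; apply: eq_in_count => m; rewrite mem_iota.
by case/andP=> ->.
Qed.

(** The end is one of the [j] returns, which leaves [j - 1] intersections. At [j = 0] both sides are
    0, as needed for [k = 1] in the theorem. *)
Lemma num_pairs_coef n (r j : nat) : (0 < n)%N ->
  (num_pairs n r (j%:Z - 1))%:R = (pair_gf (pred1 j) n 0)`_r.
Proof.
move=> n_gt0; rewrite /num_pairs cardsE -sum1_card natr_sum big_mkcond.
rewrite /pair_gf pair_big coef_sum; apply: eq_bigr => -[p q] _ /=.
rewrite unfold_in /= !point_after_end gap_end !eqz_nat.
have [pq|npq] := eqVneq (count id p) (count id q); last first.
  by rewrite andbF coef0; case: eqP => // <-; rewrite eq_sym (negbTE npq).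
rewrite andbT -pq -(num_intersectionsS n_gt0 pq).
have -> : ((num_intersections p q)%:Z == j%:Z - 1) = ((num_intersections p q).+1 == j) by lia.
by case: (_.+1 == j); rewrite ?coef0 ?coefXn ?andbF // andbT andbb eq_sym; case: eqP.
Qed.

Lemma num_pairs_neg n (r k : int) : r < 0 -> num_pairs n r k = 0%N.
Proof.
move=> r_lt0; apply/eqP; rewrite cards_eq0; apply/eqP/setP => -[p q].
by rewrite !inE /= point_after_end; case: eqP => //; lia.
Qed.

Theorem theorem4 (n : nat) (r k : int) (hn : (2 <= n)%N) (hk : 1 <= k) :
  (n%:R - k%:~R - 1) / (k%:~R + 1) * (num_pairs n r k)%:R =
    (n%:R - 2 * k%:~R) / k%:~R * (num_pairs n r (k - 1))%:R
    + (num_pairs (n - 1) r (k - 2))%:R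
    + (num_pairs (n - 1) (r - 1) (k - 2))%:R :> rat.
Proof.
case: r => [r|r]; last first.
  by rewrite !num_pairs_neg ?mulr0n ?mulr0 ?addr0 //; lia.
case: k hk => // -[//|k] _.
case: n hn => // n n_gt0; rewrite subSS subn0.
have -> : Posz k.+1 - 2 = k%:Z - 1 by lia.
have eN : (num_pairs n.+1 r k.+1)%:R = (pair_gf (pred1 k.+2) n.+1 0)`_r.
  by rewrite -num_pairs_coef //; congr (num_pairs _ _ _)%:R; lia.
(* Multiplication by [x] shifts [r]; at [r = 0] both sides vanish. *)
have eS : (num_pairs n (r%:Z - 1) (k%:Z - 1))%:R = ('X * pair_gf (pred1 k) n 0)`_r.
  rewrite coefXM; case: r {eN} => [|r]; first by rewrite num_pairs_neg.
  by have -> : r.+1%:Z - 1 = r by [lia]; rewrite num_pairs_coef.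
rewrite eN eS !num_pairs_coef // -![k.+1%:~R]/(k.+1%:R).
have /(congr1 (fun p : {poly rat} => p`_r)) := pair_gf_returns_rec k n.
rewrite mulrDl mul1r !(coefMn, coefN, coefD).
set a := (pair_gf (pred1 k.+2) _ _)`_r; set b := (pair_gf (pred1 k.+1) _ _)`_r.
set c := (pair_gf _ _ _)`_r; set d := ('X * _)`_r => e.
have k_ge0 : 0 <= k%:R :> rat by rewrite ler0n.
apply/eqP; rewrite -subr_eq0; apply/eqP.
(* Here [k.+1] and [n.+1] are the [k] and [n] of the theorem; dividing the recurrence by
   [(k + 1) (k + 2)] gives its coefficients. *)
transitivity ((a *+ (k.+1 * n.+1) - b *+ (k.+2 * n.+1)
  - (a - b *+ 2 + (c + d)) *+ (k.+1 * k.+2)) / (k.+1%:R * k.+2%:R)); last first.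
  by rewrite e subrr mul0r.
field.
by apply/andP; split; lra.
Qed.
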